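(* Let $V$ be a finite set, $f:2^V\to\mathbb{R}_+$ a nonnegative submodular function, and $t_1,\ldots,t_k\in V$ distinct terminals. Let $\mathbf{x}=(x_{i,j})_{i\in[k],j\in V}$ be a feasible solution of the relaxation $$\min \sum_{i=1}^k \hat f(\mathbf{x}_i)\quad\text{s.t.}\quad \sum_{i=1}^k x_{i,j}=1\ \ \forall j\in V,\qquad x_{i,t_i}=1\ \ \forall i\in[k],\qquad x_{i,j}\ge 0\ \ \forall i,j,$$ where $\mathbf{x}_i=(x_{i,j})_{j\in V}$. Consider the following randomized rounding: choose $\theta\in(\tfrac12,1]$ uniformly at random, let $A_i(\theta)=\{j\in V: x_{i,j}>\theta\}$ for $i\in[k]$ and $U(\theta)=V\setminus\bigcup_{i=1}^k A_i(\theta)$, choose $i'\in[k]$ uniformly at random, and assign to terminal $i$ the set $A_i(\theta)$ if $i\neq i'$ and the set $A_{i'}(\theta)\cup U(\theta)$ if $i=i'$. Then this rounding produces a feasible solution (a partition $(S_1,\ldots,S_k)$ of $V$ with $t_i\in S_i$) whose expected value $\mathbb{E}[\sum_{i=1}^k f(S_i)]$ is at most $(2-\tfrac{2}{k})\sum_{i=1}^k \hat f(\mathbf{x}_i)$.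
   Context: For $\mathbf{y}\in[0,1]^V$, the Lovász extension is $\hat f(\mathbf{y})=\mathbb{E}_{\theta}[f(\{j\in V: y_j>\theta\})]$ where $\theta$ is uniform in $[0,1]$.
   Formalization: The formal statement assumes k ≥ 2 (for k = 1 the bound is 0 and fails when f(V) > 0) and claims feasibility of the output for every θ in (1/2, 1), leaving out θ = 1, where all A_i(θ) are empty and terminals other than i' are not in their sets. *)

(* Defs.v *)
From HB Require Import structures.
From mathcomp Require Import all_boot all_order all_algebra.
From mathcomp Require Import all_classical all_reals all_analysis.
Set Implicit Arguments. Unset Strict Implicit. Unset Printing Implicit Defensive.
Import Order.TTheory GRing.Theory Num.Theory.
Local Open Scope ring_scope.

Definition submodular (R : realType) (V : finType) (f : {set V} -> R) : Prop :=
  forall A B : {set V}, f (A :|: B) + f (A :&: B) <= f A + f B.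

Definition level (R : realType) (V : finType) (y : V -> R) (theta : R) : {set V} :=
  finset (fun j => theta < y j).

Definition lovasz (R : realType) (V : finType) (f : {set V} -> R) (y : V -> R)
  : \bar R :=
  (\int[@lebesgue_measure R]_(theta in [set th : R | (0 <= th <= 1)%R])
      (f (level y theta))%:E)%E.

Definition feasible_relax (R : realType) (V : finType) (k : nat)
  (t : 'I_k -> V) (x : 'I_k -> V -> R) : Prop :=
  [/\ forall j, \sum_(i < k) x i j = 1,
      forall i, x i (t i) = 1 &
      forall i j, 0 <= x i j].

Definition A_set (R : realType) (V : finType) (k : nat)
  (x : 'I_k -> V -> R) (theta : R) (i : 'I_k) : {set V} :=
  level (x i) theta.

Definition U_set (R : realType) (V : finType) (k : nat)
  (x : 'I_k -> V -> R) (theta : R) : {set V} :=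
  ~: (\bigcup_(i < k) A_set x theta i).

Definition rounded (R : realType) (V : finType) (k : nat)
  (x : 'I_k -> V -> R) (theta : R) (i' i : 'I_k) : {set V} :=
  if i == i' then A_set x theta i :|: U_set x theta else A_set x theta i.

Definition terminal_partition (V : finType) (k : nat)
  (t : 'I_k -> V) (S : 'I_k -> {set V}) : Prop :=
  [/\ forall j : V, exists i, j \in S i,
      forall i1 i2, i1 != i2 -> [disjoint S i1 & S i2] &
      forall i, t i \in S i].

(* Expected cost of the rounding: theta uniform on (1/2,1] (density 2),
   i' uniform on [k] (probability 1/k each). *)
Definition expected_rounding_cost (R : realType) (V : finType) (k : nat)
  (f : {set V} -> R) (x : 'I_k -> V -> R) : \bar R :=
  (\sum_(i' < k) ((k%:R^-1 * 2)%:E *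
     \int[@lebesgue_measure R]_(theta in [set th : R | (2^-1 < th <= 1)%R])
        (\sum_(i < k) f (rounded x theta i' i))%:E))%E.

(* Main.v *)
Require Import Defs.
From HB Require Import structures.
From mathcomp Require Import all_boot all_order all_algebra.
From mathcomp Require Import all_classical all_reals all_analysis.
From mathcomp Require Import measurable_realfun lra ring.
Import Order.TTheory GRing.Theory Num.Theory.
Set Implicit Arguments.
Unset Strict Implicit.
Local Open Scope ring_scope.

(**
Substituting [theta -> 1 - theta], and writing [B_i = level x_i theta],
[U = U(1 - theta)], [Z_i = A_i(1 - theta) :|: U] for [0 < theta < 1/2], the
bound reduces to
  [\int \sum_i f(Z_i) <= (k - 1) \int \sum_i f(B_i)]  over [(0, 1/2)].
This does not hold pointwise in [theta].  However [Z_i = U :|: B_i], so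
submodularity gives [f(Z_i) <= f(U) + f(B_i) - f(U :&: B_i)].  The sets
[U(1 - theta)] form a chain, so the greedy algorithm yields a modular [w <= f]
with [w = f] on that chain.  With [r_u = min(1 - max_i x_{i,u}, 1/2)] and
[W = \sum_u w_u r_u], the constraint
[\sum_i x_{i,u} = 1] gives
  [\int w(U) = W],  [\sum_i \int w(U :&: B_i) = 2 W],
  [\sum_i \int w(B_i) = W + w(V) / 2],
hence [\sum_i \int f(Z_i) <= \sum_i \int f(B_i) + (k - 2) W] and
[W <= \sum_i \int f(B_i)].
*)

(** * Greedy modular minorants of a submodular function *)

Section supporting_weight.
Import mathcomp.boot.fintype mathcomp.boot.finset.

(* Nonempty [S] only: [w] is greedy for [f] with its value at the empty set
   lowered to 0. *)
Lemma submodular_supporting_weight (R : realType) (V : finType)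
    (f : {set V} -> R) (r : V -> R) (T : {set V}) :
  submodular f -> 0 <= f set0 ->
  exists w : V -> R,
    (forall S : {set V}, S \subset T -> \sum_(u in S) w u <= f S) /\
    (forall S : {set V}, S \subset T -> S != set0 ->
       (forall u v, u \in S -> v \in T -> v \notin S -> r v < r u) ->
       \sum_(u in S) w u = f S).
Proof.
move=> fsub f0; elim: {T}#|T| {-2}T (erefl #|T|) => [|n IHn] T cT.
  have T0 : T = set0 by apply: cards0_eq.
  exists (fun=> 0); rewrite T0; split=> S; rewrite subset0 => /eqP ->.
    by rewrite big_set0.
  by rewrite eqxx.
have [e0 e0T] : exists e0, e0 \in T by apply/set0Pn; rewrite -card_gt0 cT.
(* The element of least [r] comes last in the greedy order; the induction removes it first. *)
pose e := [arg min_(u < e0 in T) r u]%O.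
have [eT emin] : e \in T /\ forall v, v \in T -> r e <= r v.
  by rewrite /e; case: arg_minP => // i iT h; split.
have cT' : #|T :\ e| = n by move: cT; rewrite (cardsD1 e) eT => -[].
have [w' [w'le w'eq]] := IHn _ cT'.
(* A modular sum over the empty set is 0 while [f set0] may be positive. Lowering that value keeps
   [g <= f] and lets the greedy sums telescope. *)
pose g (S : {set V}) := if S == set0 then 0 else f S.
have gle S : g S <= f S by rewrite /g; case: eqP => // ->.
have w'leg (S : {set V}) : S \subset T :\ e -> \sum_(u in S) w' u <= g S.
  by move=> sS; rewrite /g; case: eqP => [->|_]; rewrite ?big_set0// w'le.
have w'T : \sum_(u in T :\ e) w' u = g (T :\ e).
  rewrite /g; case: eqP => [->|/eqP T0]; first by rewrite big_set0.
  by apply: w'eq => // u v _ ->.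
(* The last element receives its marginal value, so the total weight of [T] is [f T]. *)
pose w v := if v == e then f T - g (T :\ e) else w' v.
have weq (S : {set V}) : e \notin S -> \sum_(u in S) w u = \sum_(u in S) w' u.
  move=> eS; apply: eq_bigr => u uS; rewrite /w.
  by case: eqP => // ue; move: eS; rewrite -ue uS.
have we (S : {set V}) : e \in S ->
    \sum_(u in S) w u = f T - g (T :\ e) + \sum_(u in S :\ e) w' u.
  by move=> eS; rewrite (big_setD1 e eS) /= {1}/w eqxx weq// setD11.
exists w; split=> S sST.
- case: (boolP (e \in S)) => eS; last first.
    by rewrite weq// w'le// subsetD1 sST.
  rewrite we//; have := w'leg (S :\ e) (setSD _ sST).
  (* This is submodularity of [S] against [T :\ e], whose union is [T] and whose intersection is
     [S :\ e]. *)
  suff : f T + g (S :\ e) <= f S + g (T :\ e) by lra.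
  have := fsub S (T :\ e).
  have -> : S :|: (T :\ e) = T.
    apply/setP => v; rewrite !inE; have [->|] := eqVneq v e; first by rewrite eS.
    by move=> _; case vS: (v \in S) => //=; rewrite (subsetP sST).
  have -> : S :&: (T :\ e) = S :\ e.
    apply/setP => v; rewrite !inE; case vS: (v \in S); rewrite ?andbF//=.
    by rewrite (subsetP sST)// andbT.
  (* Only when [T :\ e] is empty can [g] fall below [f] there. Then [S = T], since [S] contains [e],
     and both sides agree. *)
  have [Te|Te] := eqVneq (T :\ e) set0.
    have -> : S = T.
      apply/eqP; rewrite eqEsubset sST; apply/subsetP => v vT.
      have : v \notin T :\ e by rewrite Te inE.
      by rewrite !inE vT andbT negbK => /eqP ->.
    by rewrite lexx.
  by have := gle (S :\ e); rewrite {3}/g (negbTE Te); lra.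
- move=> S0 Sup; case: (boolP (e \in S)) => eS; last first.
    rewrite weq// w'eq//; first by rewrite subsetD1 sST.
    by move=> u v uS; rewrite !inE => /andP[_ vT]; exact: Sup.
  (* An upper set for [r] that contains the minimizer [e] leaves nothing of [T] outside. *)
  have -> : S = T.
    apply/eqP; rewrite eqEsubset sST; apply/subsetP => v vT.
    case: (boolP (v \in S)) => // vS.
    by have := Sup _ _ eS vT vS; rewrite ltNge emin.
  by rewrite we// w'T subrK.
Qed.

End supporting_weight.

Local Open Scope classical_set_scope.

(** * Measurability and integrability through maps into the subsets of a finite set *)

Section set_valued_maps.
Context {d : measure_display} {T : measurableType d} {R : realType} {V : finType}.
Variables (G : T -> {set V}).
Hypothesis mG : forall u, measurable [set th | u \in G th].

Lemma measurable_fiber_set_valued (S : {set V}) :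
  measurable [set th | G th = S].
Proof.
have -> : [set th | G th = S] =
    \bigcap_(u in [set: V]) [set th | (u \in G th) = (u \in S)].
  apply/seteqP; split=> [th <- //|th /= h].
  by apply/setP => u; exact: h.
apply: fin_bigcap_measurable; first exact: finite_finset.
move=> u _; case: (u \in S); first exact: mG.
rewrite [X in measurable X](_ : _ = ~` [set th | u \in G th]).
  exact: measurableC.
by apply/seteqP; split=> th /=; [move=> ->|move/negP/negbTE].
Qed.

(** Since [G] takes finitely many values, [g \o G] is a finite combination of indicators of its
    fibers. *)
Lemma measurable_fun_comp_set_valued (g : {set V} -> R) :
  measurable_fun [set: T] (g \o G).
Proof.
have -> : g \o G = fun th => \sum_(S : {set V}) g S * \1_[set th | G th = S] th.
  apply/funext => th /=; rewrite (bigD1 (G th))//= indicE mem_set//= mulr1.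
  rewrite big1 ?addr0// => S SG; rewrite indicE memNset ?mulr0//=.
  by move=> GS; rewrite GS eqxx in SG.
apply: measurable_sum => S; apply: measurable_funM => //.
by apply: measurable_indic; exact: measurable_fiber_set_valued.
Qed.

Variables (mu : {measure set T -> \bar R}) (D : set T).
Hypotheses (mD : measurable D) (muD : (mu D < +oo)%E).

Lemma integrable_comp_set_valued (g : {set V} -> R) :
  mu.-integrable D (EFin \o (g \o G)).
Proof.
apply: measurable_bounded_integrable => //.
  exact: measurable_funS (measurable_fun_comp_set_valued g).
exists (\sum_(S : {set V}) `|g S|); split; first by rewrite num_real.
move=> x gx th _ /=; apply: le_trans (ltW gx).
by rewrite (bigD1 (G th))//= lerDl sumr_ge0.
Qed.

End set_valued_maps.

(** * Finite sums under real-valued integrals *)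

Section Rintegral_sum.
Context {d : measure_display} {T : measurableType d} {R : realType}.
Variables (mu : {measure set T -> \bar R}) (D : set T).
Hypothesis mD : measurable D.

Lemma EFin_Rintegral (g : T -> R) : mu.-integrable D (EFin \o g) ->
  (\int[mu]_(x in D) (g x)%:E)%E = (\int[mu]_(x in D) g x)%:E.
Proof. by move=> ig; rewrite /Rintegral fineK//; exact: integrable_fin_num. Qed.

Lemma integrable_sumEFin (I : Type) (s : seq I) (g : I -> T -> R) :
  (forall i, mu.-integrable D (EFin \o g i)) ->
  mu.-integrable D (EFin \o (fun x => \sum_(i <- s) g i x)).
Proof.
move=> ig; rewrite [X in integrable _ _ X](_ : _ =
    (fun x => (\sum_(i <- s) (EFin \o g i) x)%E)); first exact: integrable_sum.
by apply/funext => x /=; rewrite sumEFin.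
Qed.

Lemma integrable_scaleEFin (c : R) (g : T -> R) :
  mu.-integrable D (EFin \o g) ->
  mu.-integrable D (EFin \o (fun x => c * g x)).
Proof. by move=> ig; exact: (integrableZl mD c ig). Qed.

Lemma Rintegral_sum (I : Type) (s : seq I) (g : I -> T -> R) :
  (forall i, mu.-integrable D (EFin \o g i)) ->
  \int[mu]_(x in D) (\sum_(i <- s) g i x) = \sum_(i <- s) \int[mu]_(x in D) g i x.
Proof.
move=> ig; apply: EFin_inj; rewrite -EFin_Rintegral; last first.
  exact: integrable_sumEFin.
rewrite -sumEFin; under eq_integral do rewrite -sumEFin.
rewrite (@integral_sum _ _ _ _ _ mD _ (fun i x => (g i x)%:E) ig).
by apply: eq_bigr => i _; rewrite EFin_Rintegral.
Qed.

End Rintegral_sum.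

(** Exchanging sum and integral reduces a modular function to the measure of the parameters at which
    each single element is present. *)
Lemma Rintegral_sum_set_valued {d : measure_display} {T : measurableType d}
    {R : realType} {V : finType} (mu : {measure set T -> \bar R})
    (D : set T) (G : T -> {set V}) (w : V -> R) :
  measurable D -> (mu D < +oo)%E ->
  (forall u, measurable [set th | u \in G th]) ->
  \int[mu]_(th in D) (\sum_(u in G th) w u) =
  \sum_u w u * fine (mu ([set th | u \in G th] `&` D)).
Proof.
move=> mD muD mG.
have i1 u : mu.-integrable D (EFin \o (\1_[set th | u \in G th] : T -> R)).
  have -> : (\1_[set th | u \in G th] : T -> R) =
      (fun S : {set V} => (u \in S)%:R) \o G.
    by apply/funext => th; rewrite indicE/=; congr (nat_of_bool _)%:R;
      apply/idP/idP; rewrite inE.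
  exact: integrable_comp_set_valued.
under eq_Rintegral => th _.
  rewrite (_ : \sum_(u in G th) w u =
    \sum_u w u * \1_[set th | u \in G th] th); last first.
    rewrite big_mkcond/=; apply: eq_bigr => u _.
    rewrite indicE; case: (boolP (u \in G th)) => uG.
      by rewrite mem_set//= mulr1.
    by rewrite memNset ?mulr0//=; exact/negP.
  over.
rewrite Rintegral_sum//=; last by move=> u; exact: integrable_scaleEFin.
apply: eq_bigr => u _; rewrite RintegralZl//; congr (_ * _).
by rewrite /Rintegral integral_indic.
Qed.

(** * Reflection invariance of Lebesgue measure, and lengths of intervals *)

Lemma lebesgue_measure_reflect (R : realType) (A : set R) (c : R) : measurable A ->
  pushforward lebesgue_measure
    ((fun th => c - th) : measurableTypeR R -> measurableTypeR R) A =
  lebesgue_measure A.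
Proof.
have mc : measurable_fun [set: measurableTypeR R]
  ((fun th => c - th) : measurableTypeR R -> measurableTypeR R).
  exact: measurable_funB.
move=> mA; apply/esym.
pose mphi := isMeasurableFun.Build _ _ _ _ _ mc.
pose phi : {mfun measurableTypeR R >-> measurableTypeR R} :=
  HB.pack (fun th => c - th) mphi.
apply: (lebesgue_measure_unique (mu := pushforward lebesgue_measure phi)) => //.
move=> _ [[a b]] _ <-.
(* By uniqueness it suffices to test half-open intervals. The reflection of []a, b]] is closed on
   the other side but has the same length. *)
transitivity (lebesgue_measure (`[c - b, c - a[ : set R)); last first.
  by congr lebesgue_measure; apply/seteqP; split=> th /=; rewrite !in_itv/=; lra.
rewrite !lebesgue_measure_itv/= !lte_fin ltrD2l ltrN2.
by case: ifP => // _; rewrite -!EFinB; congr EFin; ring.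
Qed.

Lemma ge0_Rintegral_reflect (R : realType) (D : set R) (c : R) (g : R -> R) :
  measurable D -> measurable_fun [set: R] g -> (forall th, 0 <= g th) ->
  \int[@lebesgue_measure R]_(th in D) g th =
  \int[@lebesgue_measure R]_(th in [set th | D (c - th)]) g (c - th).
Proof.
have mc : measurable_fun [set: measurableTypeR R]
  ((fun th => c - th) : measurableTypeR R -> measurableTypeR R).
  exact: measurable_funB.
move=> mD mg g0; rewrite /Rintegral; congr fine.
rewrite -(ge0_integral_pushforward mc lebesgue_measure (f := EFin \o g))//=.
- apply: eq_measure_integral => A mA _.
  exact: esym (lebesgue_measure_reflect _ mA).
- by apply/measurable_EFinP; exact: measurable_funS mg.
- by move=> th _; rewrite lee_fin.
Qed.

(** Squeezing between the open and the half-open interval spares the length computations any care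
    about whether endpoints belong to [E]. *)
Lemma lebesgue_measure_between_itv0 (R : realType) (c : R) (E : set R) :
  measurable E -> 0 <= c -> `]0, c[ `<=` E -> E `<=` `]0, c] ->
  lebesgue_measure E = c%:E.
Proof.
move=> mE c0 cE Ec.
have mI (b : bool) : lebesgue_measure [set` Interval (BRight 0) (BSide b c)] = c%:E.
  rewrite lebesgue_measure_itv/= lte_fin; case: ltP => c0'.
    by rewrite sube0.
  by have -> : c = 0 by lra.
apply/eqP; rewrite eq_le; apply/andP; split.
  by rewrite -(mI false); apply: le_measure; rewrite ?inE.
by rewrite -(mI true); apply: le_measure; rewrite ?inE.
Qed.

(** * Measurability of level sets, uncovered sets and their reflections *)

Section level_sets.
Context {R : realType} {V : finType} {k : nat}.
Implicit Types (x : 'I_k -> V -> R) (y : V -> R).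

Lemma in_level y th u : (u \in level y th) = (th < y u).
Proof. by rewrite inE. Qed.

Lemma in_U_set x th u : (u \in U_set x th) = [forall i, x i u <= th].
Proof.
rewrite /U_set !inE; apply/idP/forallP => [uU i|h].
  rewrite leNgt; apply: contra uU => xi; apply/bigcupP; exists i => //.
  by rewrite inE.
by apply/negP => /bigcupP[i _]; rewrite inE ltNge h.
Qed.

Lemma measurable_level y u : measurable [set th | u \in level y th].
Proof.
rewrite (_ : [set _ | _] = `]-oo, y u[); first exact: measurable_itv.
by apply/seteqP; split=> th /=; rewrite in_level in_itv.
Qed.

Lemma measurable_U_set x u : measurable [set th | u \in U_set x th].
Proof.
rewrite (_ : [set _ | _] = \bigcap_(i in [set: 'I_k]) `[x i u, +oo[).
  apply: fin_bigcap_measurable; first exact: finite_finset.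
  by move=> i _; exact: measurable_itv.
apply/seteqP; split=> th /=; rewrite in_U_set.
  by move=> /forallP h i _ /=; rewrite in_itv/= h.
by move=> h; apply/forallP => i; have := h i I; rewrite /= in_itv/= andbT.
Qed.

Lemma measurable_reflect (G : R -> {set V}) :
  (forall u, measurable [set th | u \in G th]) ->
  forall u, measurable [set th | u \in G (1 - th)].
Proof.
move=> mG u; have := (_ : measurable_fun [set: R] (fun th : R => 1 - th)).
by move=> /(_ (measurable_funB _ _) measurableT _ (mG u)); rewrite setTI; apply.
Qed.

Lemma measurable_inU (G H : R -> {set V}) u :
  measurable [set th | u \in G th] -> measurable [set th | u \in H th] ->
  measurable [set th | u \in G th :|: H th].
Proof.
move=> mG mH; rewrite (_ : [set _ | _] =
    [set th | u \in G th] `|` [set th | u \in H th]); first exact: measurableU.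
by apply/seteqP; split=> th /=; rewrite !inE => /orP.
Qed.

Lemma measurable_inI (G H : R -> {set V}) u :
  measurable [set th | u \in G th] -> measurable [set th | u \in H th] ->
  measurable [set th | u \in G th :&: H th].
Proof.
move=> mG mH; rewrite (_ : [set _ | _] =
    [set th | u \in G th] `&` [set th | u \in H th]); first exact: measurableI.
by apply/seteqP; split=> th /=; rewrite !inE => /andP.
Qed.

End level_sets.

(** * Truncated sums of a probability vector with largest coordinate [m] *)

Section simplex_identities.
Context {R : realType} {k : nat}.
Variables (a : 'I_k -> R) (m : 'I_k).
Hypotheses (a0 : forall i, 0 <= a i) (a1 : \sum_i a i = 1).
Hypothesis am : forall i, a i <= a m.

Lemma simplex_pair_le i j : i != j -> a i + a j <= 1.
Proof.
move=> ij; rewrite -a1 (bigD1 i)//= (bigD1 j) ?(eq_sym j)//= addrA lerDl.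
by rewrite sumr_ge0.
Qed.

Lemma simplex_nonmax_le i : i != m -> a i <= 2^-1.
Proof. by move=> /simplex_pair_le; have := am i; lra. Qed.

Lemma simplex_sum_nonmax : \sum_(i | i != m) a i = 1 - a m.
Proof. by apply/eqP; rewrite eq_sym subr_eq addrC -a1 (bigD1 m). Qed.

(** Only the largest coordinate can exceed 1/2, so the truncation leaves all others intact and they
    contribute [1 - a m]. *)
Lemma simplex_sum_min_half :
  \sum_i Num.min (a i) 2^-1 = 2^-1 + Num.min (1 - a m) 2^-1.
Proof.
rewrite (bigD1 m)//= (eq_bigr a) => [|i im].
  by rewrite simplex_sum_nonmax /Num.min; case: ifP; case: ifP; lra.
by rewrite min_l// simplex_nonmax_le.
Qed.

(** A coordinate other than [m] is at most 1/2, hence at most its complement. These sum to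
    [1 - a m], and the term of [m] is settled by comparing [a m] with 1/2. *)
Lemma simplex_sum_min_compl :
  \sum_i Num.min (a i) (1 - a i) = 2 * Num.min (1 - a m) 2^-1.
Proof.
rewrite (bigD1 m)//= (eq_bigr a) => [|i im].
  by rewrite simplex_sum_nonmax /Num.min; case: ifP; case: ifP; lra.
by rewrite min_l//; have := simplex_nonmax_le im; lra.
Qed.

End simplex_identities.

(** * Feasibility of the rounding, and the reflected sets *)

Section rounding_cost.
Context {R : realType} {V : finType} {k : nat}.
Variables (f : {set V} -> R) (t : 'I_k -> V) (x : 'I_k -> V -> R).
Hypothesis f_ge0 : forall S, 0 <= f S.
Hypothesis f_sub : submodular f.
Hypothesis x_feas : feasible_relax t x.

Local Notation mu := (@lebesgue_measure R).
Local Notation half := (`]0, 2^-1[%classic : set R).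
Local Notation Z i th := (A_set x th i :|: U_set x th).

Let x_sum u : \sum_i x i u = 1. Proof. by case: x_feas. Qed.
Let x_ge0 i u : 0 <= x i u. Proof. by case: x_feas. Qed.

(** Two coordinates at one element sum to at most 1, so they cannot both exceed a threshold above
    1/2: this gives disjointness. The bound [th < 1] puts [t i] in its own set. At [th = 1], a null
    event, every [A_set] is empty. *)
Lemma terminal_partition_rounded (th : R) (i' : 'I_k) :
  2^-1 < th < 1 -> terminal_partition t (rounded x th i').
Proof.
move=> /andP[th2 th1].
have inr i u : (u \in rounded x th i' i) =
    (th < x i u) || (i == i') && [forall j, x j u <= th].
  rewrite /rounded; case: eqP => _; first by rewrite inE in_U_set in_level.
  by rewrite in_level orbF.
split.
- move=> u; have [/forallP h|] := boolP [forall j, x j u <= th].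
    by exists i'; rewrite inr eqxx /= orbC; apply/orP; left; exact/forallP.
  rewrite negb_forall => /existsP[i]; rewrite -ltNge => xi.
  by exists i; rewrite inr xi.
- move=> i1 i2 i12; rewrite -setI_eq0; apply/eqP/setP => u; rewrite !inE !inr.
  have x12 : x i1 u + x i2 u <= 1 by apply: (simplex_pair_le (a := x^~ u)).
  apply/negP => /andP[/orP[x1|/andP[/eqP e1 /forallP h1]]].
    move=> /orP[x2|/andP[_ /forallP/(_ i1)]]; first by lra.
    by rewrite leNgt x1.
  move=> /orP[x2|/andP[/eqP e2 _]]; first by have := h1 i2; rewrite leNgt x2.
  by move: i12; rewrite e1 e2 eqxx.
- by move=> i; rewrite inr; case: x_feas => _ -> _; rewrite th1.
Qed.

(** An element outside the uncovered set has some coordinate [j] above [1 - th], so all others are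
    below [th]. For it, membership at threshold [th] and at threshold [1 - th] both mean [i = j]. *)
Lemma reflected_level_setU th i : 0 < th < 2^-1 ->
  Z i (1 - th) = U_set x (1 - th) :|: level (x i) th.
Proof.
move=> th2; apply/setP => u; rewrite !finset.in_setU in_U_set !in_level.
have [h|] := boolP [forall j, x j u <= 1 - th]; first by rewrite orbT.
rewrite negb_forall orbF => /existsP[j]; rewrite -ltNge => xj /=.
have [->|ij] := eqVneq i j; first by rewrite xj; apply/esym; lra.
have := simplex_pair_le (x_ge0^~ u) (x_sum u) ij.
by move=> ?; apply/idP/idP; lra.
Qed.

Let mA i u : measurable [set th | u \in A_set x th i].
Proof. exact: measurable_level. Qed.
Let mU u : measurable [set th | u \in U_set x th].
Proof. exact: measurable_U_set. Qed.
Let mU' u : measurable [set th | u \in U_set x (1 - th)].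
Proof. exact: measurable_reflect. Qed.
Let mZ i u : measurable [set th | u \in Z i th].
Proof. exact: measurable_inU. Qed.
Let mZ' i u : measurable [set th | u \in Z i (1 - th)].
Proof. by apply: (@measurable_reflect R V (fun th => Z i th)). Qed.
Let mY i u : measurable [set th | u \in U_set x (1 - th) :&: level (x i) th].
Proof. by apply: measurable_inI; [exact: mU'|exact: measurable_level]. Qed.

Let mhalf : measurable half. Proof. exact: measurable_itv. Qed.
Let mu_itv (a b : R) (c d : bool) :
  (mu [set` Interval (BSide c a) (BSide d b)] < +oo)%E.
Proof. by rewrite lebesgue_measure_itv/=; case: ifP; rewrite ?ltry// -EFinB ltry. Qed.

(** * Lengths of the membership sets over (0, 1/2) *)

Lemma length_level i u :
  fine (mu ([set th | u \in level (x i) th] `&` half)) = Num.min (x i u) 2^-1.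
Proof.
rewrite (lebesgue_measure_between_itv0 (c := Num.min (x i u) 2^-1))//.
- by apply: measurableI => //; exact: mA.
- by rewrite le_min x_ge0/=; lra.
- move=> th /=; rewrite in_level !in_itv/= lt_min => /and3P[-> -> ->] //.
- move=> th /=; rewrite in_level !in_itv/= le_min => -[? /andP[-> ?]].
  by rewrite /=; apply/andP; split; apply/ltW.
Qed.

(** Only the largest coordinate decides membership: [u] enters the growing chain when
    [th <= 1 - x m u]. *)
Lemma length_U_set m u : (forall i, x i u <= x m u) ->
  fine (mu ([set th | u \in U_set x (1 - th)] `&` half)) =
  Num.min (1 - x m u) 2^-1.
Proof.
move=> xm; have xm1 : x m u <= 1 by rewrite -(x_sum u) (bigD1 m)//= lerDl sumr_ge0.
have Um th : (u \in U_set x (1 - th)) = (th <= 1 - x m u).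
  rewrite in_U_set; apply/forallP/idP => [/(_ m)|? i]; first by lra.
  by have := xm i; lra.
rewrite (lebesgue_measure_between_itv0 (c := Num.min (1 - x m u) 2^-1))//.
- exact: measurableI.
- by rewrite le_min; lra.
- move=> th /=; rewrite Um !in_itv/= lt_min => /and3P[-> + ->].
  by move=> /ltW ->.
- move=> th /=; rewrite Um !in_itv/= le_min => -[-> /andP[-> ?]] /=.
  exact/ltW.
Qed.

(** Once [th < x i u], every other coordinate is at most [1 - x i u < 1 - th], so only the
    coordinate [i] constrains membership. No cut at 1/2 shows in the result, because the minimum
    never exceeds 1/2. *)
Lemma length_level_U_set i u :
  fine (mu ([set th | u \in U_set x (1 - th) :&: level (x i) th] `&` half)) =
  Num.min (x i u) (1 - x i u).
Proof.
have x1 : x i u <= 1 by rewrite -(x_sum u) (bigD1 i)//= lerDl sumr_ge0.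
have Yi th : 0 < th < 2^-1 -> (u \in U_set x (1 - th) :&: level (x i) th) =
    (th < x i u) && (th <= 1 - x i u).
  move=> th2; rewrite finset.in_setI in_U_set in_level andbC.
  case: ltP => //= xi; apply/forallP/idP => [/(_ i)|? j]; first by lra.
  have [<-|ij] := eqVneq i j; first by lra.
  by have := simplex_pair_le (x_ge0^~ u) (x_sum u) ij; lra.
rewrite (lebesgue_measure_between_itv0 (c := Num.min (x i u) (1 - x i u)))//.
- exact: measurableI.
- by rewrite le_min x_ge0; lra.
- move=> th /=; rewrite !in_itv/= lt_min => /and3P[? ? ?].
  by split; [rewrite Yi|]; lra.
- move=> th /=; rewrite !in_itv/= le_min => -[+ th2].
  by rewrite Yi//; lra.
Qed.

Let iG (D : set R) (G : R -> {set V}) (g : {set V} -> R) :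
  measurable D -> (mu D < +oo)%E -> (forall u, measurable [set th | u \in G th]) ->
  mu.-integrable D (EFin \o (fun th => g (G th))).
Proof.
move=> mD muD mG.
exact: (@integrable_comp_set_valued _ (measurableTypeR R) R V G mG mu D mD muD).
Qed.

Let integral_weight (G : R -> {set V}) (w : V -> R) :
  (forall u, measurable [set th | u \in G th]) ->
  \int[mu]_(th in half) (\sum_(u in G th) w u) =
  \sum_u w u * fine (mu ([set th | u \in G th] `&` half)).
Proof.
exact: (@Rintegral_sum_set_valued _ (measurableTypeR R) R V mu half G w mhalf
  (mu_itv _ _ _ _)).
Qed.

(** * The integrated uncrossing inequality *)

Lemma uncrossing_inequality : (2 <= k)%N ->
  \sum_i \int[mu]_(th in half) f (Z i (1 - th)) <=
  (k%:R - 1) * \sum_i \int[mu]_(th in half) f (level (x i) th).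
Proof.
move=> k2; have k0 : (0 < k)%N by exact: ltnW.
pose m u := [arg max_(i > Ordinal k0) x i u]%O.
have xm u i : x i u <= x (m u) u by rewrite /m; case: arg_maxP => // j _; apply.
(* The order by [- x (m u) u] is the order in which elements enter [U_set x (1 - th)], so each of
   these sets is an upper set, on which [w] is tight if nonempty. *)
have [w [wle weq]] :=
  @submodular_supporting_weight _ _ f (fun u => - x (m u) u) finset.setT
    f_sub (f_ge0 _).
have {}wle (S : {set V}) : \sum_(u in S) w u <= f S.
  by apply: wle; exact: finset.subsetT.
(* The full set is trivially an upper set, so its weight is [f] of it, or 0 when [V] is empty. *)
have wT : 0 <= \sum_u w u.
  have [V0|V0] := eqVneq (finset.setT : {set V}) finset.set0.
    rewrite big1// => u _; have : u \in (finset.setT : {set V}) by rewrite inE.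
    by rewrite V0 inE.
  rewrite (eq_bigl [in (finset.setT : {set V})]) => [|u]; last by rewrite inE.
  by rewrite weq ?finset.subsetT// => u v _ _; rewrite inE.
have wU th : U_set x (1 - th) != finset.set0 ->
    \sum_(u in U_set x (1 - th)) w u = f (U_set x (1 - th)).
  move=> U0; apply: weq; rewrite ?finset.subsetT//.
  move=> u v; rewrite !in_U_set => /forallP/(_ (m u)) xu _.
  rewrite negb_forall => /existsP[j]; rewrite -ltNge => xv.
  by have := xm v j; lra.
pose W := \sum_u w u * Num.min (1 - x (m u) u) 2^-1.
pose JZ i := \int[mu]_(th in half) f (Z i (1 - th)).
pose JB i := \int[mu]_(th in half) f (level (x i) th).
have muh : (mu half < +oo)%E by exact: mu_itv.
have HZ i : JZ i + \sum_u w u * Num.min (x i u) (1 - x i u) <= JB i + W.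
  have -> : W = \int[mu]_(th in half) (\sum_(u in U_set x (1 - th)) w u).
    rewrite (integral_weight _ mU').
    by apply: eq_bigr => u _; rewrite (@length_U_set (m u)).
  have -> : \sum_u w u * Num.min (x i u) (1 - x i u) =
      \int[mu]_(th in half) (\sum_(u in U_set x (1 - th) :&: level (x i) th) w u).
    rewrite (integral_weight _ (mY i)).
    by apply: eq_bigr => u _; rewrite length_level_U_set.
  have iZ := iG f mhalf muh (mZ' i).
  have iB := iG f mhalf muh (mA i).
  have iY := iG (fun S => \sum_(u in S) w u) mhalf muh (mY i).
  have iU := iG (fun S => \sum_(u in S) w u) mhalf muh mU'.
  rewrite /JZ /JB -!RintegralD//; apply: le_Rintegral => //.
  - exact: (@integrableD _ (measurableTypeR R) R mu half mhalf _ _ iZ iY).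
  - exact: (@integrableD _ (measurableTypeR R) R mu half mhalf _ _ iB iU).
  move=> th; rewrite /= in_itv/= => th2; rewrite reflected_level_setU//.
  (* Tightness of [w] may fail on the empty set, but there the two sides coincide outright. *)
  have [U0|U0] := eqVneq (U_set x (1 - th)) finset.set0.
    by rewrite U0 finset.set0U finset.set0I.
  rewrite wU//; have := f_sub (U_set x (1 - th)) (level (x i) th).
  by have := wle (U_set x (1 - th) :&: level (x i) th); lra.
have HB i : \sum_u w u * Num.min (x i u) 2^-1 <= JB i.
  have -> : \sum_u w u * Num.min (x i u) 2^-1 =
      \int[mu]_(th in half) (\sum_(u in level (x i) th) w u).
    rewrite (integral_weight _ (mA i)).
    by apply: eq_bigr => u _; rewrite length_level.
  apply: le_Rintegral => //.
  - exact: (iG (fun S => \sum_(u in S) w u) mhalf muh (mA i)).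
  - exact: (iG f mhalf muh (mA i)).
have sumZ : \sum_i JZ i + 2 * W <= \sum_i JB i + k%:R * W.
  have : \sum_i (JZ i + \sum_u w u * Num.min (x i u) (1 - x i u)) <=
      \sum_i (JB i + W) by apply: ler_sum => i _; exact: HZ.
  rewrite !big_split/= sumr_const card_ord -[W *+ k]mulr_natl.
  suff -> : 2 * W = \sum_i \sum_u w u * Num.min (x i u) (1 - x i u) by [].
  rewrite exchange_big/= mulr_sumr; apply: eq_bigr => u _.
  rewrite -mulr_sumr (@simplex_sum_min_compl _ _ (x^~ u) (m u))//; ring.
(* The truncated sums add up to [W] plus half the total weight, and the latter is nonnegative by
   [wT]. *)
have sumB : W <= \sum_i JB i.
  apply: le_trans (ler_sum _ (fun i _ => HB i)).
  rewrite exchange_big/=.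
  under eq_bigr => u _ do
    rewrite -mulr_sumr (@simplex_sum_min_half _ _ (x^~ u) (m u))// mulrDr.
  by rewrite big_split/= lerDr -mulr_suml mulr_ge0.
have k2R : 2 <= k%:R :> R by rewrite ler_nat.
(* [sumZ] leaves [k - 2] copies of [W]; as [k >= 2], each may be replaced by the larger sum of the
   [JB i]. *)
have : 0 <= (k%:R - 2) * (\sum_i JB i - W) by apply: mulr_ge0; lra.
by move: sumZ; rewrite -/(\sum_i JZ i); rewrite /JZ /JB; lra.
Qed.

(** * The relaxation value and the expected cost as integrals over the two halves *)

Local Notation upper := (`]2^-1, 1]%classic : set R).

Let mupper : measurable upper. Proof. exact: measurable_itv. Qed.

Lemma lovasz_split i : lovasz f (x i) =
  (\int[mu]_(th in half) f (level (x i) th) +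
   \int[mu]_(th in upper) f (A_set x th i))%:E.
Proof.
have iA (D : set R) : measurable D -> (mu D < +oo)%E ->
    mu.-integrable D (EFin \o (fun th => f (level (x i) th))).
  by move=> mD muD; exact: (iG f mD muD (mA i)).
rewrite /lovasz (_ : [set th | _] = (`[0, 1] : set R)); last first.
  by apply/seteqP; split=> th /=; rewrite in_itv.
rewrite EFin_Rintegral//; last first.
  by apply: iA; [exact: measurable_itv|exact: mu_itv].
congr EFin.
have i01 : mu.-integrable `[0, 1] (EFin \o (fun th => f (level (x i) th))).
  by apply: iA; [exact: measurable_itv|exact: mu_itv].
have /= <- := Rintegral_itvB (x := 2^-1) i01; last 2 first.
- by rewrite bnd_simp; lra.
- by rewrite bnd_simp; lra.
rewrite Rintegral_itv_bndo_bndc; last by apply: iA => //; exact: mu_itv.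
rewrite Rintegral_itv_obnd_cbnd; last first.
  by apply: iA; [exact: measurable_itv|exact: mu_itv].
by rewrite addrC subrK.
Qed.

Lemma Rintegral_upper_reflect i :
  \int[mu]_(th in upper) f (Z i th) = \int[mu]_(th in half) f (Z i (1 - th)).
Proof.
(* Dropping the null endpoint 1 makes the reflected domain exactly the open interval [half]. *)
rewrite -Rintegral_itv_bndo_bndc; last first.
  by apply: (iG f _ _ (mZ i)); [exact: measurable_itv|exact: mu_itv].
rewrite (ge0_Rintegral_reflect 1)//; last first.
  exact: (@measurable_fun_comp_set_valued _ (measurableTypeR R) R V _ (mZ i) f).
congr (Rintegral _ _ _); apply/seteqP.
by split=> th /=; rewrite !in_itv/=; lra.
Qed.

(** For a fixed [i], the choice [i' = i] gives [Z i] and the other [k - 1] choices give [A_set]. The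
    factor is the density 2 times the probability [1 / k]. *)
Lemma expected_rounding_costE : expected_rounding_cost f x =
  (2 / k%:R * \sum_i ((k%:R - 1) * \int[mu]_(th in upper) f (A_set x th i) +
                      \int[mu]_(th in half) f (Z i (1 - th))))%:E.
Proof.
rewrite /expected_rounding_cost (_ : [set th | _] = upper); last first.
  by apply/seteqP; split=> th /=; rewrite in_itv.
have muu : (mu upper < +oo)%E by exact: mu_itv.
have ir i' i : mu.-integrable upper (EFin \o (fun th => f (rounded x th i' i))).
  by rewrite /rounded; case: eqP => _; [exact: (iG f mupper muu (mZ i))|
    exact: (iG f mupper muu (mA i))].
under eq_bigr => i' _.
  rewrite EFin_Rintegral//; last by apply: integrable_sumEFin.
  rewrite Rintegral_sum//.
  over.
rewrite sumEFin; congr EFin.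
rewrite -mulr_sumr [_^-1 * _]mulrC; congr (_ * _).
rewrite exchange_big/=; apply: eq_bigr => i _.
rewrite (bigD1 i)//= addrC; congr (_ + _).
  rewrite (eq_bigr (fun=> \int[mu]_(th in upper) f (A_set x th i))) => [|i' ii'].
    rewrite sumr_const cardC1 card_ord -[LHS]mulr_natl.
    by rewrite -[k.-1]subn1 natrB// (leq_ltn_trans (leq0n i)).
  by rewrite /rounded eq_sym (negbTE ii').
by rewrite -Rintegral_upper_reflect /rounded eqxx.
Qed.

(** As [2 - 2 / k = (2 / k) (k - 1)], the integrals over [upper] are the same on both sides; what
    remains is the uncrossing inequality. *)
Lemma expected_rounding_cost_le : (2 <= k)%N ->
  (expected_rounding_cost f x <=
   (2 - 2 / k%:R)%:E * \sum_(i < k) lovasz f (x i))%E.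
Proof.
move=> k2; rewrite expected_rounding_costE.
rewrite (eq_bigr _ (fun i _ => lovasz_split i)).
rewrite sumEFin -EFinM lee_fin !big_split/= -mulr_sumr.
have := uncrossing_inequality k2.
set Jh := \sum_i _; set JB := \sum_i _; set JA := \sum_i _ => le_Jh.
have k0 : 0 < k%:R :> R by rewrite ltr0n (leq_trans _ k2).
have -> : 2 - 2 / k%:R = 2 / k%:R * (k%:R - 1) :> R by field; lra.
by rewrite -(mulrA (2 / k%:R)) ler_pM2l ?divr_gt0// mulrDr addrC lerD2r.
Qed.

End rounding_cost.

Theorem theorem2 (R : realType) (V : finType) (k : nat) (f : {set V} -> R)
  (t : 'I_k -> V) (x : 'I_k -> V -> R) :
  (2 <= k)%N ->
  (forall S, 0 <= f S) ->
  submodular f ->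
  injective t ->
  feasible_relax t x ->
  (forall theta : R, 2^-1 < theta < 1 -> forall i' : 'I_k,
      terminal_partition t (rounded x theta i')) /\
  (expected_rounding_cost f x <=
     ((2 - 2 / k%:R)%:E * \sum_(i < k) lovasz f (x i))%E)%E.
Proof.
move=> k2 f_ge0 f_sub _ x_feas; split.
  by move=> th th2 i'; exact: terminal_partition_rounded.
exact: (expected_rounding_cost_le f_ge0 f_sub x_feas k2).
Qed.
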